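(* Let $\mathfrak{P}$ be a compactness-like topological property and let $X$ be a locally-$\mathfrak{P}$ space. Let $\zeta X$ be a compactification of $X$, let $\phi:\beta X\to\zeta X$ be the continuous extension of the identity of $X$, and let $E$ be a compact subspace of $\zeta X\setminus X$ containing $\phi[\beta X\setminus\lambda_\mathfrak{P}X]$. Then the subspace $Y=X\cup E$ of $\zeta X$ belongs to $\mathscr{E}_\mathfrak{P}(X)$. Moreover, every element of $\mathscr{E}_\mathfrak{P}(X)$ is (equivalent to an extension) of this form.
   Context: All spaces are completely regular Hausdorff; $\beta X$ is the Stone–Čech compactification. An extension of $X$ is a space containing $X$ as a dense subspace; extensions are identified up to homeomorphisms fixing $X$ pointwise. $\mathscr{E}_\mathfrak{P}(X)$ is the set of all extensions of $X$ with $\mathfrak{P}$ and compact remainder. $X$ is locally-$\mathfrak{P}$ if each point has an open neighborhood whose closure has $\mathfrak{P}$. $\lambda_\mathfrak{P}X=\bigcup\{\mathrm{int}_{\beta X}\mathrm{cl}_{\beta X}C: C\text{ a cozero-set of }X,\ \mathrm{cl}_XC\text{ has }\mathfrak{P}\}$. A topological property is compactness-like if it is hereditary to clopen subspaces, finitely additive, invariant and inverse invariant under perfect surjections, and satisfies Mrówka's condition (W): if a space $Z$ has a point $p$ with an open base $\mathscr{B}$ at $p$ such that $Z\setminus B$ has $\mathfrak{P}$ for all $B\in\mathscr{B}$, then $Z$ has $\mathfrak{P}$. *)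

(* Defs.v *)
From Stdlib Require Import Reals List Classical.
Open Scope R_scope.

Record Top := {
  pt :> Type;
  op : (pt -> Prop) -> Prop;
  op_full : op (fun _ => True);
  op_inter : forall U V, op U -> op V -> op (fun x => U x /\ V x);
  op_union : forall (F : (pt -> Prop) -> Prop),
      (forall U, F U -> op U) -> op (fun x => exists U, F U /\ U x)
}.

Arguments op {t} _.

Section Sub.
Variable (X : Top) (A : X -> Prop).
Definition subT := {x : X | A x}.
Definition sub_op (V : subT -> Prop) : Prop :=
  exists U : X -> Prop, op U /\ forall y, V y <-> U (proj1_sig y).

Lemma sub_full : sub_op (fun _ => True).
Proof. exists (fun _ => True); split; [apply op_full | tauto]. Qed.

Lemma sub_inter : forall U V, sub_op U -> sub_op V -> sub_op (fun x => U x /\ V x).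
Proof.
  intros U V [U' [HU EU]] [V' [HV EV]].
  exists (fun x => U' x /\ V' x); split; [apply op_inter; auto|].
  intro y; rewrite EU, EV; tauto.
Qed.

Lemma sub_union : forall (F : (subT -> Prop) -> Prop),
  (forall U, F U -> sub_op U) -> sub_op (fun x => exists U, F U /\ U x).
Proof.
  intros F HF.
  exists (fun x => exists U, (op U /\ exists V, F V /\ forall y, V y <-> U (proj1_sig y)) /\ U x).
  split.
  - apply op_union; intros U [H _]; exact H.
  - intro y; split.
    + intros [V [FV Vy]]. destruct (HF V FV) as [U [HU EU]].
      exists U; split; [split; [exact HU| exists V; auto] | apply EU; exact Vy].
    + intros [U [[_ [V [FV EV]]] Uy]]. exists V; split; [exact FV | apply EV; exact Uy].
Qed.

Definition sub : Top := {| pt := subT; op := sub_op; op_full := sub_full;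
  op_inter := sub_inter; op_union := sub_union |}.
End Sub.

Definition closed (X : Top) (F : X -> Prop) : Prop := op (fun x => ~ F x).
Definition closure (X : Top) (A : X -> Prop) (x : X) : Prop :=
  forall F, closed X F -> (forall y, A y -> F y) -> F x.
Definition interior (X : Top) (A : X -> Prop) (x : X) : Prop :=
  exists U, op U /\ U x /\ forall y, U y -> A y.
Definition dense (X : Top) (A : X -> Prop) : Prop := forall x, closure X A x.
Definition image {X Y : Type} (f : X -> Y) (y : Y) : Prop := exists x, f x = y.

Definition continuous {X Y : Top} (f : X -> Y) : Prop :=
  forall V : Y -> Prop, op V -> op (fun x => V (f x)).

Definition compact (X : Top) : Prop :=
  forall F : (X -> Prop) -> Prop,
    (forall U, F U -> op U) -> (forall x, exists U, F U /\ U x) ->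
    exists l : list (X -> Prop), (forall U, In U l -> F U) /\
      forall x, exists U, In U l /\ U x.

Definition hausdorff (X : Top) : Prop :=
  forall x y : X, x <> y -> exists U V, op U /\ op V /\ U x /\ V y /\
    forall z, U z -> V z -> False.

Definition rcont {X : Top} (f : X -> R) : Prop :=
  forall x eps, 0 < eps -> exists U, op U /\ U x /\
    forall y, U y -> Rabs (f y - f x) < eps.

Definition completely_regular (X : Top) : Prop :=
  forall (F : X -> Prop) (x : X), closed X F -> ~ F x ->
    exists f : X -> R, rcont f /\ f x = 0 /\ forall y, F y -> f y = 1.

Definition tychonoff (X : Top) : Prop := completely_regular X /\ hausdorff X.

Definition embedding {X Y : Top} (f : X -> Y) : Prop :=
  (forall x x', f x = f x' -> x = x') /\ continuous f /\
  forall U : X -> Prop, op U -> exists V : Y -> Prop, op V /\ forall x, U x <-> V (f x).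

Definition homeomorphism {X Y : Top} (f : X -> Y) : Prop :=
  exists g : Y -> X, continuous f /\ continuous g /\
    (forall x, g (f x) = x) /\ (forall y, f (g y) = y).

Definition closed_map {X Y : Top} (f : X -> Y) : Prop :=
  forall F : X -> Prop, closed X F -> closed Y (fun y => exists x, F x /\ f x = y).

Definition perfect_surj {X Y : Top} (f : X -> Y) : Prop :=
  continuous f /\ closed_map f /\ (forall y, exists x, f x = y) /\
  forall y, compact (sub X (fun x => f x = y)).

Definition open_base_at (Z : Top) (p : Z) (Bs : (Z -> Prop) -> Prop) : Prop :=
  (forall B, Bs B -> op B /\ B p) /\
  forall U, op U -> U p -> exists B, Bs B /\ forall z, B z -> U z.

Definition compactness_like (P : Top -> Prop) : Prop :=
  (forall X : Top, tychonoff X -> P X ->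
     forall A : X -> Prop, op A -> closed X A -> P (sub X A)) /\
  (forall X : Top, tychonoff X -> forall (n : nat) (A : nat -> X -> Prop),
     (forall i, (i < n)%nat -> closed X (A i) /\ P (sub X (A i))) ->
     (forall i j, (i < n)%nat -> (j < n)%nat -> i <> j ->
        forall x, A i x -> A j x -> False) ->
     (forall x, exists i, (i < n)%nat /\ A i x) -> P X) /\
  (forall (X Y : Top) (f : X -> Y), tychonoff X -> tychonoff Y ->
     perfect_surj f -> P X -> P Y) /\
  (forall (X Y : Top) (f : X -> Y), tychonoff X -> tychonoff Y ->
     perfect_surj f -> P Y -> P X) /\
  (* Mrowka's condition (W) *)
  (forall (Z : Top) (p : Z) (Bs : (Z -> Prop) -> Prop), tychonoff Z ->
     open_base_at Z p Bs ->
     (forall B, Bs B -> P (sub Z (fun z => ~ B z))) -> P Z).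

Definition locally_P (P : Top -> Prop) (X : Top) : Prop :=
  forall x : X, exists U, op U /\ U x /\ P (sub X (closure X U)).

Definition stone_cech (X K : Top) (e : X -> K) : Prop :=
  compact K /\ hausdorff K /\ embedding e /\ dense K (image e) /\
  forall (Z : Top) (g : X -> Z), compact Z -> hausdorff Z -> continuous g ->
    exists G : K -> Z, continuous G /\ forall x, G (e x) = g x.

Definition compactification (X Z : Top) (z : X -> Z) : Prop :=
  compact Z /\ hausdorff Z /\ embedding z /\ dense Z (image z).

Definition cozero (X : Top) (C : X -> Prop) : Prop :=
  exists f : X -> R, rcont f /\ forall x, C x <-> f x <> 0.

(* lambda_P X inside betaX = K (X embedded via e) *)
Definition lambdaP (P : Top -> Prop) (X K : Top) (e : X -> K) (p : K) : Prop :=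
  exists C : X -> Prop, cozero X C /\ P (sub X (closure X C)) /\
    interior K (closure K (fun q => exists x, C x /\ e x = q)) p.

Definition inEP (P : Top -> Prop) (X T : Top) (j : X -> T) : Prop :=
  tychonoff T /\ embedding j /\ dense T (image j) /\ P T /\
  compact (sub T (fun t => ~ image j t)).

Definition XuE (X Z : Top) (z : X -> Z) (E : Z -> Prop) : Z -> Prop :=
  fun q => image z q \/ E q.

Definition XuE_inc (X Z : Top) (z : X -> Z) (E : Z -> Prop) (x : X)
  : sub Z (XuE X Z z E) :=
  exist _ (z x) (or_introl (ex_intro _ x eq_refl)).

(* Main.v *)
(** Let [Y] be [X ∪ E]. If [V] is an open neighbourhood of [E] in [ζX], then [phi] pulls [ζX \ V]
  back to a compact subset of [lambda_P X], so [X \ V] is covered by finitely many [cl_X C] having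
  [P], and the closed subspace [Y \ V = X \ V] of [Y] has [P]. Collapsing [E] to a point is a
  perfect map onto a space which therefore has [P] by condition (W), and [P] pulls back to [Y].

  Conversely, let [T] be an extension of [X] with [P] and compact remainder. Any compactification
  [Z] of [T] is also one of [X], and [E] is the remainder [T \ X], closed in [Z]. If [phi p] is not
  in [E], some real function [f] on [Z] vanishes on a neighbourhood of [E] but not at [phi p]. The
  closure in [X] of the trace [C] on [X] of the cozero-set of [f] stays away from [E], so it is
  closed in [T] and has [P], while [p] is interior to the closure of [C] in [βX].

  That [P] passes to closed subspaces is no part of the hypotheses: for a perfect map [A -> B],
  onto or not, [B] is a perfect image of [A + B], in which [A] is clopen, so [P] passes from [B]
  to [A]. *)
From HB Require Import structures.
From mathcomp Require Import all_boot order ssralg ssrnum interval.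
From mathcomp Require Import boolp classical_sets reals topology normedtype.
From mathcomp Require Import Rstruct_topology.
From Stdlib Require Import Reals List.
Require Import Defs.

Set Implicit Arguments.
Unset Strict Implicit.
Unset Printing Implicit Defensive.

Import Order.TTheory GRing.Theory Num.Theory.

Local Open Scope classical_set_scope.
Local Open Scope ring_scope.

(* [compact] is a property of spaces, defined by covers; compactness of subsets is the library's,
   defined by filters. *)
Local Notation compact_set := compact.compact.

(** * Spaces as topological types *)

HB.instance Definition _ (X : Top) := gen_eqMixin X.
HB.instance Definition _ (X : Top) := gen_choiceMixin X.

Lemma op_bigcup (X : Top) (I : Type) (U_ : I -> set X) :
  (forall i, op (U_ i)) -> op (\bigcup_i U_ i).
Proof.
move=> opU; rewrite (_ : \bigcup_i U_ i = fun x => exists U, range U_ U /\ U x).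
  by apply: op_union => _ [i _ <-].
apply/seteqP; split=> x /= => [[i _ Ux]|[_ [[i _ <-]] Ux]]; last by exists i.
by exists (U_ i); split=> //; exists i.
Qed.

HB.instance Definition _ (X : Top) :=
  isOpenTopological.Build X (op_full X) (@op_inter X) (@op_bigcup X).

Lemma op_ext (X : Top) (U V : set X) : (forall x, U x <-> V x) -> op U -> op V.
Proof. by move=> /predeqP ->. Qed.

Lemma closed_topE (X : Top) : @closed X = @topology_structure.closed X.
Proof. by apply/funext => F; rewrite -openC. Qed.

Lemma closure_topE (X : Top) : @closure X = @topology_structure.closure X.
Proof.
apply/funext => A; rewrite topology_structure.closureE; apply/seteqP.
split=> x clAx F; first by case=> cF AF; apply: clAx; rewrite ?closed_topE.
by rewrite closed_topE => cF AF; apply: clAx.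
Qed.

Lemma closureP (X : Top) (A : set X) (x : X) :
  closure X A x <-> forall U, op U -> U x -> exists y, A y /\ U y.
Proof.
rewrite closure_topE; split=> [clAx U opU Ux|meetA B].
  by have [y []] := clAx U (open_nbhs_nbhs (conj opU Ux)); exists y.
rewrite nbhsE => -[U [opU Ux] UB]; have [y [Ay Uy]] := meetA U opU Ux.
by exists y; split=> //; exact: UB.
Qed.

Lemma closure_closed (X : Top) (A : set X) : closed X (closure X A).
Proof. by rewrite closed_topE closure_topE; exact: closed_closure. Qed.

Lemma closed_setC (X : Top) (U : set X) : op U -> closed X (~` U).
Proof. by rewrite closed_topE closedC. Qed.

Lemma closed_set0 (X : Top) : closed X set0.
Proof. by rewrite closed_topE; exact: closed0. Qed.

Lemma closed_setT (X : Top) : closed X setT.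
Proof. by rewrite closed_topE; exact: closedT. Qed.

Lemma closed_setU (X : Top) (F G : set X) : closed X F -> closed X G -> closed X (F `|` G).
Proof. by rewrite !closed_topE; exact: closedU. Qed.

Lemma closed_setI (X : Top) (F G : set X) : closed X F -> closed X G -> closed X (F `&` G).
Proof. by rewrite !closed_topE; exact: closedI. Qed.

Lemma continuous_topP (X Y : Top) (f : X -> Y) : continuous f <-> filter.continuous f.
Proof. exact: iff_sym (topology_structure.continuousP _). Qed.

Lemma closed_preimage (X Y : Top) (f : X -> Y) (F : set Y) :
  continuous f -> closed Y F -> closed X (f @^-1` F).
Proof. by move=> cf; exact: cf. Qed.

Lemma rcontP (X : Top) (f : X -> R) : rcont f <-> filter.continuous f.
Proof.
have cvgf x := cvgrPdist_lt (V := R^o) (FF := nbhs_filter x) f (f x).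
split=> [cf x|cf x e /RltP e0].
  apply/cvgf => e /RltP e0; have [U [opU [Ux Uf]]] := cf x e e0.
  apply: filterS (open_nbhs_nbhs (conj opU Ux)) => y /Uf /RltP.
  by rewrite distrC.
have [U [opU Ux Uf]] := (cvgf x).1 (cf x) e e0.
exists U; do 2!split=> //; move=> y /Uf /=.
by rewrite distrC => /RltP.
Qed.

Definition top_of (T : topologicalType) : Top.
Proof.
refine {| pt := T; op := @open T |}.
- exact: openT.
- exact: openI.
- move=> F opF; rewrite (_ : (fun _ => _) = \bigcup_(U in F) U); first exact: bigcup_open.
  by apply/seteqP; split=> x [U]; [move=> [FU Ux]; exists U|move=> FU Ux; exists U].
Defined.

Lemma hausdorff_top_of (T : topologicalType) : hausdorff (top_of T) <-> hausdorff_space T.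
Proof.
rewrite open_hausdorff; split=> hT x y.
  move=> /eqP/hT [U [V [opU [opV [Ux [Vy UV]]]]]].
  exists (U, V); rewrite ?inE//; split=> //=; rewrite -subset0.
  by move=> z []; exact: UV.
move=> /(@eqP T)/hT[[U V] /= []]; rewrite !inE => Ux Vy [opU opV UV].
exists U, V; do 4!split=> //; move=> z Uz Vz.
by have : (U `&` V) z by []; rewrite UV.
Qed.

Lemma hausdorff_topP (X : Top) : hausdorff X <-> hausdorff_space X.
Proof. exact: (hausdorff_top_of X). Qed.

Lemma compact_ind (T : topologicalType) (A : set T) (Q : set (set T)) :
  compact_set A -> Q set0 -> setU_closed Q ->
  (forall U V, U `<=` V -> Q V -> Q U) ->
  (forall x, A x -> exists U, [/\ open U, U x & Q U]) -> Q A.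
Proof.
move=> cA Q0 QU QS QA; apply: contrapT => nQA.
pose F : set_system T := [set B | Q (A `\` B)].
have FF : ProperFilter F.
  apply: Build_ProperFilter; first by rewrite /F/= setD0.
  split; rewrite /F; first by rewrite /= setDT.
    by move=> B C QB QC; rewrite /= setDIr; exact: QU.
  by move=> B C BC; apply: QS; apply: setDS.
have [|x [Ax clFx]] := cA F FF; first by rewrite /F/= setDv.
have [U [opU Ux QUU]] := QA x Ax.
have [|y []//] := clFx (~` U) U _ (open_nbhs_nbhs (conj opU Ux)).
by apply: QS QUU => y [_ /contrapT].
Qed.

Definition finitely_covered (T : Type) (F : set (set T)) (A : set T) : Prop :=
  exists l : list (set T), (forall U, In U l -> F U) /\
    forall x, A x -> exists U, In U l /\ U x.

Lemma compact_topP (X : Top) : compact X <-> compact_set [set: X].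
Proof.
split=> [cX F PF _|cX F opF covF].
  apply: contrapT => noncluster.
  have [|x|l [lF lcov]] := cX [set U | op U /\ F (~` U)]; first by move=> U [].
    have /existsNP[A /existsNP[B]] : ~ cluster F x.
      by move=> clx; apply: noncluster; exists x.
    rewrite not_implyE nbhsE => -[FA /not_implyP[[U [opU Ux] UB] AB0]].
    exists U; do 2!split=> //; apply: filterS FA => y Ay Uy.
    by apply: AB0; exists y; split=> //; apply: UB.
  have : F (fun x => forall U, In U l -> ~ U x).
    elim: l lF {lcov} => [|U l IH] lF; first by apply: filterS filterT.
    have [_ FU] := lF U (or_introl erefl).
    have FV := IH (fun V lV => lF V (or_intror lV)).
    by apply: filterS (filterI FU FV) => x [nUx nVx] V [<-|/nVx].
  by move=> /filter_ex[x nUx]; have [U [/nUx]] := lcov x.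
suff [l [lF lcov]] : finitely_covered F [set: X].
  by exists l; split=> // x; apply: lcov.
apply: (compact_ind cX).
- by exists nil.
- move=> U V [l [lF lU]] [m [mF mV]]; exists (l ++ m)%list; split=> [W|x].
    by rewrite in_app_iff => -[/lF|/mF].
  by case=> [/lU|/mV] [W [lW Wx]]; exists W; rewrite in_app_iff; split=> //; [left|right].
- by move=> U V UV [l [lF lV]]; exists l; split=> // x /UV /lV.
- move=> x _; have [U [FU Ux]] := covF x; exists U; split=> //; first exact: opF.
  by exists [:: U]; split=> [V [<-|[]]//|y Uy]; exists U; split=> //; left.
Qed.

(** * Subspaces and embeddings *)

Definition incl (X : Top) (A : set X) (y : sub X A) : X := proj1_sig y.

Definition corestrict (X Y : Top) (f : X -> Y) (S : set Y) (fS : forall x, S (f x)) (x : X) :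
  sub Y S := exist _ (f x) (fS x).

Lemma incl_inj (X : Top) (A : set X) : injective (@incl X A).
Proof. by move=> [x Ax] [y Ay] /= xy; exact: eq_exist. Qed.

Lemma embedding_continuous (X Y : Top) (f : X -> Y) : embedding f -> continuous f.
Proof. by move=> [_ []]. Qed.

Lemma continuous_incl (X : Top) (A : set X) : continuous (@incl X A).
Proof. by move=> V opV; exists V. Qed.

Lemma embedding_incl (X : Top) (A : set X) : embedding (@incl X A).
Proof. by split; [exact: incl_inj|split; [exact: continuous_incl|move=> U [V []]; exists V]]. Qed.

Lemma range_incl (X : Top) (A : set X) : range (@incl X A) = A.
Proof. by apply/seteqP; split=> [_ [[x Ax] _ <-]//|x Ax]; exists (exist _ x Ax). Qed.

Definition surjective (T U : Type) (f : T -> U) : Prop := forall y, exists x, f x = y.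

Lemma image_range (T U : Type) (f : T -> U) : image f = range f.
Proof. by apply/seteqP; split=> [y [x <-]|_ [x _ <-]]; exists x. Qed.

Lemma continuous_comp (X Y Z : Top) (g : Y -> Z) (f : X -> Y) :
  continuous g -> continuous f -> continuous (g \o f).
Proof. by move=> cg cf V /cg; apply: cf. Qed.

Lemma embedding_comp (X Y Z : Top) (g : Y -> Z) (f : X -> Y) :
  embedding g -> embedding f -> embedding (g \o f).
Proof.
move=> [injg [cg opg]] [injf [cf opf]]; split; first by move=> x y /injg/injf.
split=> [|U /opf[V [/opg[W [opW WE]] VE]]]; first exact: continuous_comp.
by exists W; split=> // x; rewrite VE WE.
Qed.

Lemma embedding_corestrict (X Y : Top) (f : X -> Y) (S : set Y) (fS : forall x, S (f x)) :
  embedding f -> embedding (corestrict fS).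
Proof.
move=> [injf [cf opf]]; split; first by move=> x y /(congr1 (@incl Y S))/injf.
split=> [V [W [opW VW]]|U /opf[V [opV UV]]].
  by apply: op_ext (cf W opW) => x; exact: iff_sym (VW (corestrict fS x)).
by exists (@incl Y S @^-1` V); split; [exact: (@continuous_incl Y S V opV)|exact: UV].
Qed.

Lemma dense_corestrict (X Y : Top) (f : X -> Y) (S : set Y) (fS : forall x, S (f x)) :
  (forall y, S y -> closure Y (image f) y) -> dense (sub Y S) (image (corestrict fS)).
Proof.
move=> Sf y; apply/closureP => U [V [opV UV]] /UV Vy.
have [_ [[x <-] Vx]] := (closureP _ _).1 (Sf _ (proj2_sig y)) V opV Vy.
by exists (corestrict fS x); split; [exists x|exact/UV].
Qed.

Lemma embedding_homeomorphism (X Y : Top) (f : X -> Y) :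
  embedding f -> surjective f -> homeomorphism f.
Proof.
move=> [injf [cf opf]] /choice[g fg]; exists g; split=> //; split; last first.
  by split=> // x; apply: injf; rewrite fg.
move=> U /opf[V [opV UV]]; apply: op_ext opV => y.
by rewrite UV fg.
Qed.

Lemma embedding_closure (X K : Top) (e : X -> K) (C : set X) (x : X) :
  embedding e -> closure K (fun q => exists c, C c /\ e c = q) (e x) -> closure X C x.
Proof.
move=> [_ [_ ope]] /closureP clx; apply/closureP => U /ope[V [opV UV]] /UV Vx.
have [_ [[c [Cc <-]] Vc]] := clx V opV Vx.
by exists c; split=> //; exact/UV.
Qed.

Lemma dense_op_closure (X K : Top) (e : X -> K) (U : set K) :
  dense K (image e) -> op U -> U `<=` closure K (fun q => exists x, U (e x) /\ e x = q).
Proof.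
move=> de opU q Uq; apply/closureP => V opV Vq.
have [_ [[x <-] [Ux Vx]]] := (closureP _ _).1 (de q) _ (openI opU opV) (conj Uq Vq).
by exists (e x); split; first exists x.
Qed.

Lemma compact_set_image (S T : topologicalType) (f : S -> T) (A : set S) :
  filter.continuous f -> compact_set A -> compact_set (f @` A).
Proof. by move=> cf; apply: continuous_compact; exact: continuous_subspaceT. Qed.

Lemma embedding_preimage_compact (X Y : Top) (f : X -> Y) (A : set Y) :
  embedding f -> A `<=` range f -> compact_set A -> compact_set (f @^-1` A).
Proof.
move=> [_ [_ opf]] fA cA F PF FA.
have [|_ [/[dup]/fA[x _ <-] Afx] clfx] := cA (f @ F) _; first exact: FA.
exists x; split=> // B C FB; rewrite nbhsE => -[U [/opf[V [opV UV]] /UV Vfx] UC].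
have [|_ [[y By <-] Vfy]] := clfx (f @` B) V _ (open_nbhs_nbhs (conj opV Vfx)).
  exact: filterS (@preimage_image _ _ f B) FB.
by exists y; split=> //; apply/UC/UV.
Qed.

Lemma compact_sub (X : Top) (A : set X) : compact (sub X A) <-> compact_set A.
Proof.
rewrite compact_topP; split=> [cA|cA].
  rewrite -(range_incl A); apply: compact_set_image cA.
  exact/continuous_topP/continuous_incl.
rewrite (_ : setT = @incl X A @^-1` A).
  by apply: embedding_preimage_compact; rewrite ?range_incl//; exact: embedding_incl.
by apply/seteqP; split=> // y _; exact: (proj2_sig y).
Qed.

(** * Complete regularity and compactifications *)

Lemma rcont_cst (X : Top) (c : R) : rcont (fun _ : X => c).
Proof. by apply/rcontP => x; exact: cst_continuous. Qed.

Lemma rcont_comp (X Y : Top) (f : X -> Y) (g : Y -> R) :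
  rcont g -> continuous f -> rcont (g \o f).
Proof.
move=> cg cf x e /(cg (f x))[U [opU [Ux Ug]]]; exists (f @^-1` U).
by split; [exact: cf|split=> // y /Ug].
Qed.

Lemma rcont_preimage_op (X : Top) (f : X -> R) (U : set R) : rcont f -> open U -> op (f @^-1` U).
Proof. by move=> /rcontP/(continuousP _) cf /cf. Qed.

Lemma embedding_hausdorff (X Y : Top) (f : X -> Y) : embedding f -> hausdorff Y -> hausdorff X.
Proof.
move=> [injf [cf _]] hY x y xy.
have [|U [V [opU [opV [Ux [Vy UV]]]]]] := hY (f x) (f y); first by move=> /injf.
exists (f @^-1` U), (f @^-1` V); split; first exact: cf.
by split; [exact: cf|do 2!split=> //; move=> z; exact: UV].
Qed.

Lemma embedding_tychonoff (X Y : Top) (f : X -> Y) : embedding f -> tychonoff Y -> tychonoff X.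
Proof.
move=> ef [crY /(embedding_hausdorff ef) hX]; split=> // F x cF nFx.
have [_ [cf opf]] := ef; have [V [opV FV]] := opf _ cF.
have [||g [cg [gx gF]]] := crY (~` V) (f x).
- exact: closed_setC.
- by apply; exact/FV.
exists (g \o f); split; first exact: rcont_comp.
by split=> // y Fy; apply: gF => /FV.
Qed.

Lemma rcont_separates_points (X : Top) (f : X -> R) (x y : X) : rcont f -> f x <> f y ->
  exists U V, op U /\ op V /\ U x /\ V y /\ forall z, U z -> V z -> False.
Proof.
move=> cf fxy; have hR := (hausdorff_top_of R).2 (@Rhausdorff R).
have [U [V [opU [opV [Ux [Vy UV]]]]]] := hR _ _ fxy.
exists (f @^-1` U), (f @^-1` V); split; first exact: rcont_preimage_op.
by split; [exact: rcont_preimage_op|do 2!split=> //; move=> z; exact: UV].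
Qed.

Lemma T1_tychonoff (X : Top) :
  completely_regular X -> (forall x : X, closed X [set x]) -> tychonoff X.
Proof.
move=> crX T1; split=> // x y xy.
have [|f [cf [fx fy]]] := crX [set y] x (T1 y); first exact: xy.
by apply: (rcont_separates_points cf); rewrite fx fy// => /esym; exact: R1_neq_R0.
Qed.

Lemma tychonoff_sub (X : Top) (A : set X) : tychonoff X -> tychonoff (sub X A).
Proof. exact/embedding_tychonoff/embedding_incl. Qed.

Lemma closed_point (X : Top) (x : X) : hausdorff X -> closed X [set x].
Proof.
move=> /hausdorff_topP/hausdorff_accessible/accessible_closed_set1 closed1.
by rewrite closed_topE; exact: closed1.
Qed.

Lemma compact_set_closed (X : Top) (A : set X) :
  hausdorff X -> compact_set A -> closed X A.
Proof. by move=> /hausdorff_topP hX cA; rewrite closed_topE; exact: compact_closed. Qed.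

Lemma compact_hausdorff_separation (X : Top) (A B : set X) :
  compact X -> hausdorff X -> closed X A -> closed X B -> A `<=` ~` B ->
  exists f : X -> R, rcont f /\ (forall x, A x -> f x = 0) /\ forall x, B x -> f x = 1.
Proof.
rewrite compact_topP !closed_topE => cX /hausdorff_topP hX cA cB /disjoints_subset AB.
have sepAB := (normal_separatorP (R := R)).1 (compact_normal hX cX) A B cA cB AB.
have [f [cf _ fA fB]] := (uniform_separatorP (R := R) A B).1 sepAB.
exists f; split; first exact/rcontP.
by split=> x ?; [apply: fA|apply: fB]; exists x.
Qed.

Lemma compact_hausdorff_tychonoff (X : Top) : compact X -> hausdorff X -> tychonoff X.
Proof.
move=> cX hX; split=> // F x cF nFx.
have [|f [cf [fx fF]]] := compact_hausdorff_separation cX hX (closed_point x hX) cF.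
  by move=> y ->.
by exists f; split=> //; split=> //; exact: fx.
Qed.

Lemma compact_hausdorff_cozero_separation (X : Top) (F : set X) (p : X) :
  compact X -> hausdorff X -> closed X F -> ~ F p ->
  exists (f : X -> R) (N : set X),
    [/\ rcont f, f p <> 0, op N, F `<=` N & N `<=` f @^-1` [set 0]].
Proof.
move=> cX hX cF nFp; have nX := compact_normal ((hausdorff_topP X).1 hX) ((compact_topP X).1 cX).
have cp := closed_point p hX; have pF : [set p] `<=` ~` F by move=> _ ->.
have [|||U [N [opU opN pU FN UN]]] := (normal_openP (R := R)).1 nX [set p] F.
- by rewrite -closed_topE.
- by rewrite -closed_topE.
- exact/disjoints_subset.
have [||f [cf [fU fp]]] := compact_hausdorff_separation (A := ~` U) cX hX _ cp.
- exact: closed_setC.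
- by move=> x nUx xp; apply: nUx; exact: pU.
exists f, N; split=> //; first by rewrite fp//; exact: R1_neq_R0.
by move=> x Nx; apply: fU => Ux; rewrite -[False]/(set0 x) -UN.
Qed.

Lemma compact_top_of (T : topologicalType) (A : set T) :
  compact_set A -> compact_set (A : set (top_of T)).
Proof.
move=> cA; rewrite -[X in compact_set X]image_id.
by apply: (compact_set_image _ cA); apply/continuousP.
Qed.

Lemma continuous_top_of (X : Top) (T : topologicalType) (f : X -> T) :
  filter.continuous f -> continuous (f : X -> top_of T).
Proof. by move=> /topology_structure.continuousP cf V /cf. Qed.

Lemma closed_real_point (r : R) : topology_structure.closed [set r].
Proof. exact/accessible_closed_set1/hausdorff_accessible/Rhausdorff. Qed.

Definition unit_clamp (r : R) : R := Num.min 1 (Num.max 0 r).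

Lemma continuous_unit_clamp (X : Top) (f : X -> R) :
  rcont f -> filter.continuous (unit_clamp \o f).
Proof.
move=> /rcontP cf x.
apply: (@continuous_min R X (fun=> 1) (fun y => Num.max 0 (f y))); first exact: cst_continuous.
by apply: (@continuous_max R X (fun=> 0)); [exact: cst_continuous|exact: cf].
Qed.

Lemma unit_clamp_itv (r : R) : 0 <= unit_clamp r <= 1.
Proof. by rewrite /unit_clamp le_min le_max ge_min !lexx ler01. Qed.

Lemma unit_clamp0 : unit_clamp 0 = 0.
Proof. by rewrite /unit_clamp maxxx min_r ?ler01. Qed.

Lemma unit_clamp1 : unit_clamp 1 = 1.
Proof. by rewrite /unit_clamp max_r ?ler01// minxx. Qed.

Definition cube (I : choiceType) : Top := top_of (prod_topology (fun _ : I => R)).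

Definition unit_cube (I : choiceType) : set (cube I) :=
  [set c | forall i, `[0%R, 1%R]%classic (c i)].

Lemma hausdorff_cube (I : choiceType) : hausdorff (cube I).
Proof. by apply/hausdorff_top_of; apply: hausdorff_product => i; exact: Rhausdorff. Qed.

Lemma compact_unit_cube (I : choiceType) : compact_set (@unit_cube I).
Proof.
apply: (@compact_top_of (prod_topology (fun _ : I => R))).
exact: (@function_spaces.tychonoff I (fun=> R) (fun=> `[0%R, 1%R]%classic)
  (fun=> @segment_compact R 0 1)).
Qed.

Section Evaluation.
Variable X : Top.
Hypothesis tX : tychonoff X.

Definition real_functions : choiceType := {classic {g : X -> R | rcont g}}.

Definition coordinate (g : real_functions) (x : X) : R := unit_clamp (sval g x).

Definition evaluation : X -> cube real_functions := join_product coordinate.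

Lemma continuous_coordinate g : filter.continuous (coordinate g).
Proof. exact: continuous_unit_clamp (svalP g). Qed.

Lemma coordinates_separate : separate_points_from_closed coordinate.
Proof.
move=> F x; rewrite -closed_topE => cF /(tX.1 F x cF)[g [cg [gx gF]]].
exists (exist _ g cg : real_functions).
rewrite topology_structure.closureE => clgx.
have : [set 1] (unit_clamp 0).
  rewrite -gx; apply: (smallest_sub (@closed_real_point 1) _ clgx) => _ [y Fy <-].
  by rewrite /coordinate /= gF//; exact: unit_clamp1.
by rewrite unit_clamp0 => /esym/eqP; rewrite oner_eq0.
Qed.

Lemma embedding_evaluation : embedding evaluation.
Proof.
have /hausdorff_topP/hausdorff_accessible aX := tX.2.
have inj := join_product_inj coordinates_separate aX.
have opE := join_product_initial coordinates_separate continuous_coordinate inj.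
split; first by move=> x y; apply: inj; rewrite inE.
split=> [|U opU].
  exact/continuous_top_of/(join_product_continuous coordinates_separate continuous_coordinate).
have : open U by []; rewrite opE => -[V opV <-].
by exists V.
Qed.

End Evaluation.

Lemma compactification_comp (X T Z : Top) (j : X -> T) (i : T -> Z) :
  embedding j -> dense T (image j) -> compactification T Z i -> compactification X Z (i \o j).
Proof.
move=> ej dj [cZ [hZ [ei di]]]; do 2!split=> //; split; first exact: embedding_comp.
move=> q F cF jF; apply: (di q F cF) => _ [t <-].
apply: (dj t (i @^-1` F)) => [|_ [x <-]]; last by apply: jF; exists x.
exact: closed_preimage (embedding_continuous ei) cF.
Qed.

Lemma compactification_closure (X Y : Top) (f : X -> Y) (B : set Y)
    (clf : forall x, closure Y (image f) (f x)) :
  hausdorff Y -> embedding f -> compact_set B -> range f `<=` B ->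
  compactification X (sub Y (closure Y (image f))) (corestrict clf).
Proof.
move=> hY ef cB fB; split.
  apply/compact_sub/(subclosed_compact _ cB); first by rewrite -closed_topE; exact: closure_closed.
  move=> y; apply; last by move=> _ [x <-]; apply: fB; exists x.
  exact: compact_set_closed.
split; first exact: embedding_hausdorff (@embedding_incl _ _) hY.
by split; [exact: embedding_corestrict|exact: dense_corestrict].
Qed.

Lemma tychonoff_compactification (X : Top) :
  tychonoff X -> exists (Z : Top) (z : X -> Z), compactification X Z z.
Proof.
move=> tX; have clev x : closure _ (image (@evaluation X)) (evaluation x).
  by move=> F _; apply; exists x.
exists (sub _ (closure _ (image (@evaluation X)))), (corestrict clev).
apply: (compactification_closure (B := @unit_cube _)).
- exact: hausdorff_cube.
- exact: embedding_evaluation.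
- exact: compact_unit_cube.
- by move=> _ [x _ <-] g; rewrite /= in_itv /= unit_clamp_itv.
Qed.

Lemma tychonoff_separation (X : Top) (A F : set X) :
  tychonoff X -> compact_set A -> closed X F -> A `<=` ~` F ->
  exists f : X -> R, rcont f /\ (forall x, A x -> f x = 0) /\ forall x, F x -> f x = 1.
Proof.
move=> tX cA cF AF.
have [Z [z [cZ [hZ [[injz [cz opz]] _]]]]] := tychonoff_compactification tX.
have [V [opV FV]] := opz _ cF.
have [|||||f [cf [fA fV]]] := @compact_hausdorff_separation Z (z @` A) (~` V).
- exact: cZ.
- exact: hZ.
- apply: compact_set_closed hZ _; apply: compact_set_image cA.
  exact/continuous_topP.
- exact: closed_setC.
- by rewrite setCK => _ [x Ax <-]; apply/FV/AF.
exists (f \o z); split; first exact: rcont_comp.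
by split=> x => [Ax|Fx]; [apply: fA; exists x|apply: fV => /FV].
Qed.

(** * Perfect maps *)

Definition perfect_map (X Y : Top) (f : X -> Y) : Prop :=
  [/\ continuous f, closed_map f & forall y, compact_set (f @^-1` [set y])].

Lemma perfect_map_perfect_surj (X Y : Top) (f : X -> Y) :
  perfect_map f -> surjective f -> perfect_surj f.
Proof. by move=> [cf clf Kf] sf; do 3!split=> //; move=> y; exact/compact_sub/Kf. Qed.

Lemma injective_closed_map_perfect (X Y : Top) (f : X -> Y) :
  continuous f -> closed_map f -> injective f -> perfect_map f.
Proof.
move=> cf clf injf; split=> // y; have [[x fxy]|nofib] := pselect (exists x, f x = y).
  rewrite (_ : _ @^-1` _ = [set x]); first exact: compact_set1.
  by apply/seteqP; split=> z /= => [|->//]; rewrite -fxy => /injf.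
rewrite (_ : _ @^-1` _ = set0); first exact: compact0.
by rewrite -subset0 => x fxy; apply: nofib; exists x.
Qed.

Lemma embedding_perfect_map (X Y : Top) (f : X -> Y) :
  embedding f -> closed Y (image f) -> perfect_map f.
Proof.
move=> [injf [cf opf]] cimf; apply: injective_closed_map_perfect => // F cF.
have [V [opV FV]] := opf _ cF.
rewrite (_ : (fun y => _) = image f `&` ~` V).
  by apply: closed_setI => //; exact: closed_setC.
apply/seteqP; split=> [_ [x [Fx <-]]|_ [[x <-] nVx]].
  by split; [exists x|move=> /FV].
by exists x; split=> //; apply: contrapT => /FV.
Qed.

Lemma embedding_perfect_surj (X Y : Top) (f : X -> Y) :
  embedding f -> surjective f -> perfect_surj f.
Proof.
move=> ef sf; apply: (perfect_map_perfect_surj _ sf); apply: embedding_perfect_map => //.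
rewrite (_ : image f = setT); first exact: closed_setT.
by apply/seteqP; split=> // y _; exact: sf.
Qed.

Lemma injective_closed_map_embedding (X Y : Top) (f : X -> Y) :
  continuous f -> closed_map f -> injective f -> embedding f.
Proof.
move=> cf clf injf; split=> //; split=> // U opU.
exists (~` (fun y => exists x, ~ U x /\ f x = y)).
split; first by apply: (clf (~` U)); exact: closed_setC.
move=> x; split=> [Ux [y [nUy /injf yx]]|imnU]; first by rewrite yx in nUy.
by apply: contrapT => nUx; apply: imnU; exists x.
Qed.

Lemma perfect_incl (X : Top) (A : set X) : closed X A -> perfect_map (@incl X A).
Proof.
move=> cA; apply: embedding_perfect_map; first exact: embedding_incl.
by rewrite image_range range_incl.
Qed.

Definition sub_incl (X : Top) (A B : set X) (AB : A `<=` B) : sub X A -> sub X B :=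
  corestrict (fun y : sub X A => AB (incl y) (proj2_sig y)).

Lemma perfect_sub_incl (X : Top) (A B : set X) (AB : A `<=` B) :
  closed X A -> perfect_map (sub_incl AB).
Proof.
move=> cA; apply: embedding_perfect_map.
  exact/embedding_corestrict/embedding_incl.
rewrite (_ : image _ = @incl X B @^-1` A); first exact: continuous_incl cA.
apply/seteqP; split=> [_ [[x Ax] <-]//|y Ay].
by exists (exist _ (incl y) Ay); apply: incl_inj.
Qed.

Lemma perfect_id (X : Top) : perfect_map (@id X).
Proof.
apply: injective_closed_map_perfect => // F; apply: op_ext => x.
by split=> nFx; [move=> [y [Fy yx]]; apply: nFx; rewrite -yx|move=> Fx; apply: nFx; exists x].
Qed.

Lemma closed_map_point (X Y : Top) (f : X -> Y) (x : X) :
  closed_map f -> closed X [set x] -> closed Y [set f x].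
Proof.
move=> clf /clf; apply: op_ext => y; split=> ny.
  by move=> yfx; apply: ny; exists x.
by move=> [_ [-> xy]]; exact: ny.
Qed.

Lemma closed_map_comp (X Y Z : Top) (g : Y -> Z) (f : X -> Y) :
  closed_map g -> closed_map f -> closed_map (g \o f).
Proof.
move=> clg clf F /clf/clg; apply: op_ext => z; split=> nz; apply: contra_not nz.
  by move=> [x [Fx <-]]; exists (f x); split=> //; exists x.
by move=> [_ [[x [Fx <-]] <-]]; exists x.
Qed.

(** * Topological sums *)

Definition sum_op (A B : Top) (U : set (A + B)) : Prop := op (inl @^-1` U) /\ op (inr @^-1` U).

Definition sum_top (A B : Top) : Top.
Proof.
refine {| pt := (A + B)%type; op := @sum_op A B |}.
- by split; exact: openT.
- by move=> U V [UA UB] [VA VB]; split; exact: openI.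
- move=> F opF; split.
    apply: op_ext (bigcup_open (D := F) (f := fun U => inl @^-1` U) _) => [a|U /opF[]//].
    by split=> [[U FU Ua]|[U [FU Ua]]]; exists U.
  apply: op_ext (bigcup_open (D := F) (f := fun U => inr @^-1` U) _) => [b|U /opF[]//].
  by split=> [[U FU Ub]|[U [FU Ub]]]; exists U.
Defined.

Definition sum_map (A B : Top) (C : Type) (f : A -> C) (g : B -> C) (s : sum_top A B) : C :=
  match s with inl a => f a | inr b => g b end.

Lemma rcont_sum_map (A B : Top) (f : A -> R) (g : B -> R) :
  rcont f -> rcont g -> rcont (sum_map f g).
Proof.
move=> cf cg; apply/rcontP/continuousP => V opV.
by split; [exact: (rcont_preimage_op cf opV)|exact: (rcont_preimage_op cg opV)].
Qed.

Lemma embedding_inl (A B : Top) : embedding (inl : A -> sum_top A B).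
Proof.
split; first by move=> a a' [].
split=> [V []//|U opU]; exists (fun s => if s is inl a then U a else False).
by split=> //; split=> //; exact: open0.
Qed.

Lemma embedding_inr (A B : Top) : embedding (inr : B -> sum_top A B).
Proof.
split; first by move=> b b' [].
split=> [V []//|U opU]; exists (fun s => if s is inr b then U b else False).
by split=> //; split=> //; exact: open0.
Qed.

Lemma image_inlC (A B : Top) : ~` (image inl) = image inr :> set (sum_top A B).
Proof.
by apply/seteqP; split=> [[a|b] /=|_ [b <-] [a]//]; [case; exists a|exists b].
Qed.

Lemma op_image_inl (A B : Top) : op (image inl : set (sum_top A B)).
Proof.
split; first by apply: op_ext (openT (T := A)) => a; split=> // _; exists a.
by apply: op_ext (open0 (T := B)) => b; split=> // -[].
Qed.

Lemma op_image_inr (A B : Top) : op (image inr : set (sum_top A B)).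
Proof.
split; last by apply: op_ext (openT (T := B)) => b; split=> // _; exists b.
by apply: op_ext (open0 (T := A)) => a; split=> // -[].
Qed.

Lemma closed_image_inl (A B : Top) : closed (sum_top A B) (image inl).
Proof. by rewrite closed_topE -openC image_inlC; exact: op_image_inr. Qed.

Lemma closed_image_inr (A B : Top) : closed (sum_top A B) (image inr).
Proof. by rewrite -image_inlC; apply/closed_setC/op_image_inl. Qed.

Lemma perfect_inl (A B : Top) : perfect_map (inl : A -> sum_top A B).
Proof. exact/(embedding_perfect_map (@embedding_inl A B))/closed_image_inl. Qed.

Lemma perfect_inr (A B : Top) : perfect_map (inr : B -> sum_top A B).
Proof. exact/(embedding_perfect_map (@embedding_inr A B))/closed_image_inr. Qed.

Lemma tychonoff_sum (A B : Top) : tychonoff A -> tychonoff B -> tychonoff (sum_top A B).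
Proof.
move=> [crA hA] [crB hB]; apply: T1_tychonoff => [F [a|b] [FA FB] nF|[a|b]].
- have [f [cf [fa fF]]] := crA _ a FA nF.
  exists (sum_map f (fun=> R1)); split; first exact/rcont_sum_map/rcont_cst.
  by split=> // -[a'|b'] // /fF.
- have [f [cf [fb fF]]] := crB _ b FB nF.
  exists (sum_map (fun=> R1) f); split; first exact/rcont_sum_map/cf/rcont_cst.
  by split=> // -[a'|b'] // /fF.
- by have [_ cl _] := @perfect_inl A B; exact/(closed_map_point cl)/closed_point.
- by have [_ cl _] := @perfect_inr A B; exact/(closed_map_point cl)/closed_point.
Qed.

Lemma perfect_sum_map (A B C : Top) (f : A -> C) (g : B -> C) :
  perfect_map f -> perfect_map g -> perfect_map (sum_map f g).
Proof.
move=> [cf clf Kf] [cg clg Kg]; split.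
- by move=> V opV; split; [exact: cf|exact: cg].
- move=> F [FA FB].
  rewrite (_ : (fun y => _) = (fun y => exists a, F (inl a) /\ f a = y) `|`
                              (fun y => exists b, F (inr b) /\ g b = y)).
    by apply: closed_setU; [exact: clf|exact: clg].
  apply/seteqP; split=> y; first by move=> [[a|b] [Fs <-]]; [left; exists a|right; exists b].
  by case=> [[a [Fa <-]]|[b [Fb <-]]]; [exists (inl a)|exists (inr b)].
- move=> y; rewrite (_ : _ @^-1` _ =
      (inl : A -> sum_top A B) @` (f @^-1` [set y]) `|`
      (inr : B -> sum_top A B) @` (g @^-1` [set y])).
    apply: compactU; apply: compact_set_image => //; apply/continuous_topP.
      by have [] := @perfect_inl A B.
    by have [] := @perfect_inr A B.
  apply/seteqP; split; first by move=> [a|b] /= fy; [left; exists a|right; exists b].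
  by move=> s [[a fa <-]|[b gb <-]].
Qed.

(** * Collapsing a compact set to a point *)

Definition final_top (X : Top) (Y : Type) (f : X -> Y) : Top.
Proof.
refine {| pt := Y; op := fun V => op (f @^-1` V) |}.
- exact: openT.
- by move=> U V; exact: openI.
- move=> F opF; apply: op_ext (bigcup_open (D := F) (f := fun U => f @^-1` U) opF) => x.
  by split=> [[U FU Ux]|[U [FU Ux]]]; exists U.
Defined.

Lemma rcont_final (X : Top) (Y : Type) (f : X -> Y) (g : final_top f -> R) :
  rcont (g \o f) -> rcont g.
Proof. by move=> cgf; apply/rcontP/continuousP => V opV; exact: rcont_preimage_op cgf opV. Qed.

Section Collapse.
Variables (X : Top) (A : set X).

Definition collapse_map (x : X) : option (sub X (~` A)) :=
  match pselect (A x) with left _ => None | right nAx => Some (exist _ x nAx) end.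

(* The point [None] stands for [A]; if [A] is empty, it is isolated and not in the image of
   [collapse_map]. *)
Definition collapse : Top := final_top collapse_map.

Lemma collapse_map_None (x : X) : collapse_map x = None <-> A x.
Proof. by rewrite /collapse_map; case: pselect. Qed.

Lemma collapse_map_Some (x : X) (y : sub X (~` A)) : collapse_map x = Some y <-> x = incl y.
Proof.
rewrite /collapse_map; case: pselect => [Ax|nAx]; split=> //; last 2 first.
- by move=> [<-].
- by move=> xy; congr Some; apply: incl_inj.
by move=> xy; case: (proj2_sig y); rewrite -/(incl y) -xy.
Qed.

Hypotheses (tX : tychonoff X) (cA : compact_set A).

Let closedA : closed X A.
Proof. exact: compact_set_closed tX.2 cA. Qed.

Lemma preimage_collapse_map (c : collapse) :
  collapse_map @^-1` [set c] = if c is Some y then [set incl y] else A.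
Proof.
case: c => [y|]; apply/predeqP => x; first exact: collapse_map_Some.
exact: collapse_map_None.
Qed.

Lemma collapse_map_eq (x y : X) : collapse_map x = collapse_map y <-> x = y \/ A x /\ A y.
Proof.
split=> [|[->//|[/collapse_map_None -> /collapse_map_None ->]//]].
case fy: (collapse_map y) => [z|]; last by move=> fx; right; split; exact/collapse_map_None.
by move=> /collapse_map_Some ->; left; move/collapse_map_Some: fy => ->.
Qed.

Lemma closed_map_collapse : closed_map (collapse_map : X -> collapse).
Proof.
move=> F cF; have [[a [Fa Aa]]|FA] := pselect (exists a, F a /\ A a).
  apply: op_ext (closed_setU cF closedA) => x; split=> nx; apply: contra_not nx.
    by move=> [y [Fy /collapse_map_eq[<-|[_ Ax]]]]; [left|right].
  by case=> [Fx|Ax]; [exists x|exists a; split=> //; apply/collapse_map_eq; right].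
apply: op_ext cF => x; split=> nx; apply: contra_not nx; last by exists x.
by move=> [y [Fy /collapse_map_eq[<-//|[Ay _]]]]; case: FA; exists y.
Qed.

Lemma perfect_collapse : perfect_map (collapse_map : X -> collapse).
Proof.
split=> [V //||c]; first exact: closed_map_collapse.
by rewrite preimage_collapse_map; case: c => [y|//]; exact: compact_set1.
Qed.

Lemma rcont_collapse (f : X -> R) (r : R) :
  rcont f -> (forall x, A x -> f x = r) -> rcont (oapp (f \o @incl X (~` A)) r : collapse -> R).
Proof.
move=> cf fA; apply: rcont_final; rewrite (_ : _ \o _ = f)//; apply/funext => x /=.
case fx: (collapse_map x) => [y|] /=; first by move: fx => /collapse_map_Some ->.
by rewrite fA//; apply/collapse_map_None.
Qed.

Lemma completely_regular_collapse : completely_regular collapse.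
Proof.
move=> F c cF nFc; have cF' : closed X (collapse_map @^-1` F) := cF.
have F_out (y : sub X (~` A)) : F (Some y) -> F (collapse_map (incl y)).
  by rewrite (collapse_map_Some _ y).2.
case: c nFc => [y|] nFc; last first.
  have [|f [cf [fA fF]]] := tychonoff_separation tX cA cF'.
    by move=> x /collapse_map_None fx; rewrite /= fx.
  exists (oapp (f \o @incl X (~` A)) R0); split; first exact: rcont_collapse.
  by split=> // -[z /F_out/fF|].
have [||f [cf [fy fFA]]] := tX.1 (collapse_map @^-1` F `|` A) (incl y).
- exact: closed_setU.
- by case=> [/=|/(proj2_sig y)//]; rewrite (collapse_map_Some _ y).2.
exists (oapp (f \o @incl X (~` A)) R1); split.
  by apply: rcont_collapse => // x Ax; apply: fFA; right.
by split=> // -[z /F_out Fz|//]; apply: fFA; left.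
Qed.

Lemma tychonoff_collapse : tychonoff collapse.
Proof.
apply: T1_tychonoff completely_regular_collapse _ => c.
suff : closed X (collapse_map @^-1` [set c]) by [].
by rewrite preimage_collapse_map; case: c => [y|//]; exact: closed_point tX.2.
Qed.

End Collapse.

(** * Compactness-like properties *)

Section CompactnessLike.
Variable P : Top -> Prop.
Hypothesis HP : compactness_like P.

Lemma compactness_like_embedding (X Y : Top) (f : X -> Y) :
  tychonoff Y -> embedding f -> P X <-> P (sub Y (image f)).
Proof.
move=> tY ef; have fim x : image f (f x) by exists x.
have efim := embedding_corestrict fim ef.
have sur : surjective (corestrict fim).
  by move=> [y [x xy]]; exists x; apply: incl_inj.
have perf := embedding_perfect_surj efim sur.
have tX := embedding_tychonoff ef tY; have tS := tychonoff_sub (image f) tY.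
have [_ [_ [perfect_image [perfect_preimage _]]]] := HP.
by split; [exact: perfect_image perf|exact: perfect_preimage perf].
Qed.

Lemma compactness_like_trace (X Y : Top) (f : X -> Y) (S : set Y) :
  tychonoff Y -> embedding f -> S `<=` image f -> P (sub X (f @^-1` S)) <-> P (sub Y S).
Proof.
move=> tY ef Sf; have eS := embedding_comp ef (@embedding_incl X (f @^-1` S)).
rewrite (compactness_like_embedding tY eS) (_ : image _ = S)//.
apply/seteqP; split=> [_ [[x Sx] <-]//|y Sy].
by have [x xy] := Sf y Sy; rewrite -xy in Sy *; exists (exist _ x Sy).
Qed.

Lemma compactness_like_empty (X : Top) : tychonoff X -> (X -> False) -> P X.
Proof.
move=> tX X0; have [_ [closed_cover _]] := HP.
apply: (closed_cover X tX 0%N (fun=> set0)).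
- by move=> i /ssrnat.ltP.
- by move=> i k /ssrnat.ltP.
- by move=> x; case: (X0 x).
Qed.

Lemma compactness_like_sum (A B : Top) :
  tychonoff A -> tychonoff B -> P A -> P B -> P (sum_top A B).
Proof.
move=> tA tB PA PB; have tAB := tychonoff_sum tA tB.
pose parts i : set (sum_top A B) := if i is 0%N then image inl else image inr.
have [_ [closed_cover _]] := HP; apply: (closed_cover _ tAB 2%N parts).
- move=> [|i] _; split.
  + exact: closed_image_inl.
  + exact/(compactness_like_embedding tAB (@embedding_inl A B)).
  + exact: closed_image_inr.
  + exact/(compactness_like_embedding tAB (@embedding_inr A B)).
- by move=> [|[|i]] [|[|k]] /ssrnat.ltP // _ /ssrnat.ltP // _ _ _ [a <-] [].
- by move=> [a|b]; [exists 0%N|exists 1%N]; split;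
    [apply/ssrnat.ltP|exists a|apply/ssrnat.ltP|exists b].
Qed.

Lemma compactness_like_perfect_map (A B : Top) (f : A -> B) :
  tychonoff A -> tychonoff B -> perfect_map f -> P B -> P A.
Proof.
move=> tA tB pf PB; have tAB := tychonoff_sum tA tB.
have [clopen [_ [_ [perfect_preimage _]]]] := HP.
apply/(compactness_like_embedding tAB (@embedding_inl A B))/clopen => //.
- apply: perfect_preimage tAB tB _ PB.
  by apply: (perfect_map_perfect_surj (perfect_sum_map pf (@perfect_id B))) => b; exists (inr b).
- exact: op_image_inl.
- exact: closed_image_inl.
Qed.

Lemma compactness_like_closed (X : Top) (A B : set X) :
  tychonoff X -> closed X A -> A `<=` B -> P (sub X B) -> P (sub X A).
Proof.
move=> tX cA AB; apply: compactness_like_perfect_map (perfect_sub_incl AB cA); exact: tychonoff_sub.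
Qed.

Lemma compactness_like_setU (X : Top) (A B : set X) : tychonoff X -> closed X A -> closed X B ->
  P (sub X A) -> P (sub X B) -> P (sub X (A `|` B)).
Proof.
move=> tX cA cB PA PB.
have [tA tB tAB] := And3 (tychonoff_sub A tX) (tychonoff_sub B tX) (tychonoff_sub (A `|` B) tX).
have [_ [_ [perfect_image _]]] := HP.
apply: perfect_image (tychonoff_sum tA tB) tAB _ (compactness_like_sum tA tB PA PB).
apply: perfect_map_perfect_surj.
  exact: perfect_sum_map (perfect_sub_incl (@subsetUl _ A B) cA)
                         (perfect_sub_incl (@subsetUr _ A B) cB).
by move=> [x [Ax|Bx]]; [exists (inl (exist _ x Ax))|exists (inr (exist _ x Bx))]; apply: incl_inj.
Qed.

(* Condition (W) at the point to which [A] is collapsed. *)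
Lemma compactness_like_Mrowka_compact (X : Top) (A : set X) : tychonoff X -> compact_set A ->
  (forall V, op V -> A `<=` V -> P (sub X (~` V))) -> P X.
Proof.
move=> tX cA PV; have tC := tychonoff_collapse tX cA.
have [cf clf _] := perfect_collapse tX cA.
apply: (compactness_like_perfect_map tX tC (perfect_collapse tX cA)).
have [_ [_ [_ [_ Mrowka]]]] := HP.
apply: (Mrowka (collapse A) None (fun B => op B /\ B None) tC).
  by split=> // U opU U0; exists U.
move=> B [opB B0]; pose V := collapse_map A @^-1` B.
have AV : A `<=` V by move=> x /collapse_map_None; rewrite /V /= => ->.
have cV : closed X (~` V) by exact: closed_setC.
pose f : sub X (~` V) -> collapse A := collapse_map A \o @incl X (~` V).
have ef : embedding f.
  apply: injective_closed_map_embedding.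
  - exact: continuous_comp cf (@continuous_incl _ _).
  - by apply: closed_map_comp clf _; have [] := perfect_incl cV.
  - by move=> x y /collapse_map_eq[/incl_inj//|[Ax _]]; case: (proj2_sig x); exact: AV.
rewrite -[fun _ => _]/(~` B) (_ : ~` B = image f).
  by apply/(compactness_like_embedding tC ef)/PV.
apply/seteqP; split=> [[y nBy|//]|_ [[x nVx] <-]//].
have fy : collapse_map A (incl y) = Some y by exact/collapse_map_Some.
have nVy : (~` V) (incl y) by rewrite /V /= fy.
by exists (exist _ (incl y) nVy).
Qed.

End CompactnessLike.

(** * Adjoining a compact part of a compactification *)

Lemma lambdaP_compact (P : Top -> Prop) (X K : Top) (e : X -> K) (Q : set K) :
  compactness_like P -> tychonoff X -> embedding e -> compact_set Q ->
  Q `<=` lambdaP P X K e ->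
  exists D, [/\ closed X D, P (sub X D) & e @^-1` Q `<=` D].
Proof.
move=> HP tX ee cQ Qlambda.
pose small := [set U | exists D, [/\ closed X D, P (sub X D) & e @^-1` U `<=` D]].
apply: (compact_ind (Q := small) cQ).
- exists set0; split=> //; first exact: closed_set0.
  by apply: (compactness_like_empty HP); [exact: tychonoff_sub|case].
- move=> U V [D [cD PD UD]] [G [cG PG VG]]; exists (D `|` G); split.
  + exact: closed_setU.
  + exact: compactness_like_setU.
  + by move=> x [/UD|/VG]; [left|right].
- by move=> U V UV [D [cD PD VD]]; exists D; split=> // x /UV /VD.
- move=> p /Qlambda[C [_ [PC [U [opU [Up UC]]]]]]; exists U; split=> //.
  exists (closure X C); split=> //; first exact: closure_closed.
  by move=> x /UC; exact: embedding_closure.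
Qed.

Section Adjunction.
Variables (P : Top -> Prop) (X K : Top) (e : X -> K) (Z : Top) (z : X -> Z).
Variables (phi : K -> Z) (E : set Z).
Hypotheses (HP : compactness_like P) (tX : tychonoff X) (Ke : stone_cech X K e).
Hypotheses (Zz : compactification X Z z) (cphi : continuous phi).
Hypotheses (phie : forall x, phi (e x) = z x) (Ez : E `<=` ~` image z).
Hypotheses (cE : compact_set E) (lambdaE : forall p, ~ lambdaP P X K e p -> E (phi p)).

Let Y := sub Z (XuE X Z z E).
Let j : X -> Y := XuE_inc X Z z E.

Lemma tychonoff_XuE : tychonoff Y.
Proof. by have [cZ [hZ _]] := Zz; exact/tychonoff_sub/compact_hausdorff_tychonoff. Qed.

Lemma embedding_XuE_inc : embedding j.
Proof. by have [_ [_ [ez _]]] := Zz; exact: embedding_corestrict. Qed.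

Lemma compact_XuE_remainder : compact_set (@incl Z (XuE X Z z E) @^-1` E).
Proof.
apply: embedding_preimage_compact cE; first exact: embedding_incl.
by rewrite range_incl => q; right.
Qed.

Lemma XuE_remainderE : ~` image j = @incl Z (XuE X Z z E) @^-1` E.
Proof.
apply/seteqP; split=> [[q [[x zx]|//]] njq|y Ey [x jx]].
  by case: njq; exists x; apply: incl_inj.
by apply: (Ez Ey); exists x; rewrite -jx.
Qed.

Lemma XuE_property : P Y.
Proof.
have [cK [_ [ee _]]] := Ke; have tY := tychonoff_XuE; have ej := embedding_XuE_inc.
apply: (compactness_like_Mrowka_compact HP tY compact_XuE_remainder) => V opV EV.
have [W [opW VW]] := opV.
have [||D [cD PD WD]] := lambdaP_compact HP tX ee (Q := ~` (phi @^-1` W)).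
- apply: subclosed_compact ((compact_topP K).1 cK) _ => //.
  by rewrite -closed_topE; apply/closed_setC/cphi.
- move=> p nWp; apply: contrapT => /lambdaE Ep; apply: nWp.
  by apply/(VW (exist _ (phi p) (or_intror Ep)))/EV.
have Vj : ~` V `<=` image j by rewrite -[image j]setCK XuE_remainderE => y nVy /EV.
apply/(compactness_like_trace HP tY ej Vj)/(compactness_like_closed HP tX _ _ PD).
  exact/(closed_preimage (embedding_continuous ej))/closed_setC.
by move=> x nVx; apply: WD; rewrite /= phie => /(VW (j x)).
Qed.

Lemma XuE_inEP : inEP P X Y j.
Proof.
have [_ [_ [_ dz]]] := Zz.
split; first exact: tychonoff_XuE.
split; first exact: embedding_XuE_inc.
split; first by apply: dense_corestrict => q _; exact: dz.
split; first exact: XuE_property.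
by apply/compact_sub; move: compact_XuE_remainder; rewrite -XuE_remainderE.
Qed.

End Adjunction.

(** * The remainder of an extension *)

Section Remainder.
Variables (P : Top -> Prop) (X K T : Top) (e : X -> K) (j : X -> T) (Z : Top) (i : T -> Z).
Hypotheses (HP : compactness_like P) (tX : tychonoff X) (Ke : stone_cech X K e).
Hypotheses (Tj : inEP P X T j) (Zi : compactification T Z i).

Definition remainder : set Z := i @` ~` image j.

Lemma remainder_disjoint : remainder `<=` ~` image (i \o j).
Proof.
have [_ [_ [[inji _] _]]] := Zi.
by move=> _ [t njt <-] [x /inji jx]; apply: njt; exists x.
Qed.

Lemma compact_remainder : compact_set remainder.
Proof.
have [_ [_ [_ [_ cT]]]] := Tj; have [_ [_ [[_ [ci _]] _]]] := Zi.
by apply: compact_set_image; [exact/continuous_topP|exact/compact_sub].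
Qed.

Lemma lambdaP_remainder (phi : K -> Z) (p : K) :
  continuous phi -> (forall x, phi (e x) = i (j x)) ->
  ~ lambdaP P X K e p -> remainder (phi p).
Proof.
move=> cphi phie nlambda; apply: contrapT => nEp; apply: nlambda.
have [tT [ej [dj [PT _]]]] := Tj; have [cZ [hZ [ei _]]] := Zi; have [_ [_ [ee [de _]]]] := Ke.
have cE := compact_set_closed hZ compact_remainder.
have [f [N [cf fp opN EN Nf]]] := compact_hausdorff_cozero_separation cZ hZ cE nEp.
have cfphi := rcont_comp cf cphi; pose U := (f \o phi) @^-1` [set~ 0].
have opU : op U by apply: rcont_preimage_op cfphi _; rewrite openC; exact: closed_real_point.
pose S := ~` (i @^-1` N); have cS : closed T S.
  exact/closed_setC/(embedding_continuous ei).
have Sj : S `<=` image j.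
  by move=> t nNt; apply: contrapT => njt; apply: nNt; apply: EN; exists t.
have US : closure X (e @^-1` U) `<=` j @^-1` S.
  move=> x; apply=> [|y Uy Ny]; first exact: closed_preimage (embedding_continuous ej) cS.
  by apply: Uy; rewrite /= phie; exact: Nf.
exists (e @^-1` U); split.
  by exists (f \o phi \o e); split; first exact: rcont_comp (embedding_continuous ee).
split; last by exists U; split=> //; split=> //; exact: dense_op_closure.
apply: (compactness_like_closed HP tX (@closure_closed _ _) US).
apply/(compactness_like_trace HP tT ej Sj).
exact: (compactness_like_perfect_map HP (tychonoff_sub S tT) tT (perfect_incl cS) PT).
Qed.

Lemma remainder_homeomorphism :
  exists h : T -> sub Z (XuE X Z (i \o j) remainder), homeomorphism h /\ forall t, incl (h t) = i t.
Proof.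
have [_ [_ [ei _]]] := Zi.
have iXuE t : XuE X Z (i \o j) remainder (i t).
  by have [[x <-]|njt] := pselect (image j t); [left; exists x|right; exists t].
exists (corestrict iXuE); split=> //.
apply: embedding_homeomorphism; first exact: embedding_corestrict.
by move=> [q [[x ijx]|[t njt itq]]]; [exists (j x)|exists t]; apply: incl_inj.
Qed.

End Remainder.

Theorem theorem4p9 (P : Top -> Prop) (X K : Top) (e : X -> K) :
  compactness_like P -> tychonoff X -> locally_P P X -> stone_cech X K e ->
  (forall (Z : Top) (z : X -> Z) (phi : K -> Z) (E : Z -> Prop),
     compactification X Z z ->
     continuous phi -> (forall x, phi (e x) = z x) ->
     (forall q, E q -> ~ image z q) -> compact (sub Z E) ->
     (forall p, ~ lambdaP P X K e p -> E (phi p)) ->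
     inEP P X (sub Z (XuE X Z z E)) (XuE_inc X Z z E))
  /\
  (forall (T : Top) (j : X -> T), inEP P X T j ->
     exists (Z : Top) (z : X -> Z) (E : Z -> Prop),
       compactification X Z z /\
       (forall q, E q -> ~ image z q) /\ compact (sub Z E) /\
       (forall phi : K -> Z, continuous phi -> (forall x, phi (e x) = z x) ->
          forall p, ~ lambdaP P X K e p -> E (phi p)) /\
       exists h : T -> sub Z (XuE X Z z E),
         homeomorphism h /\ forall x, h (j x) = XuE_inc X Z z E x).
Proof.
move=> HP tX _ Ke; split=> [Z z phi E Zz cphi phie Ez /compact_sub cE lambdaE|T j Tj].
  exact: (XuE_inEP HP tX Ke Zz cphi phie Ez cE lambdaE).
have [Z [i Zi]] := tychonoff_compactification Tj.1.
exists Z, (i \o j), (remainder j i).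
split; first exact: compactification_comp Tj.2.1 Tj.2.2.1 Zi.
split; first exact: remainder_disjoint Zi.
split; first exact/compact_sub/(compact_remainder Tj Zi).
split; first by move=> phi cphi phie p; exact: (lambdaP_remainder HP tX Ke Tj Zi).
have [h [hh hi]] := remainder_homeomorphism j Zi.
by exists h; split=> // x; apply: incl_inj; exact: hi.
Qed.
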